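(* Let $\Theta=\{\theta_1,\theta_2,\ldots,\theta_n\}$ with $n\ge 2$, and let $m_1(\cdot)$ and $m_2(\cdot)$ be two basic belief assignments on $2^\Theta$ such that there exist indices $1\le i\ne j\le n$ with $m_1(\theta_i)=m_2(\theta_j)=1$, all other masses being $0$. Then Dempster's rule of conditioning (with $m=m_1$ and $m_A=m_2$, $A=\theta_j$) cannot be applied, because its denominator is zero: $$1-\sum_{X,Y\in 2^\Theta,\ X\cap Y=\emptyset} m_1(X)\,m_2(Y)=0.$$
   Context: Shafer's model is used: $\theta_1,\ldots,\theta_n$ are exclusive and exhaustive, and $2^\Theta$ is the set of all subsets of $\Theta$, with $\theta_i$ identified with $\{\theta_i\}$. A basic belief assignment on $2^\Theta$ is a map $m:2^\Theta\to[0,1]$ with $m(\emptyset)=0$ and $\sum_{A\in 2^\Theta}m(A)=1$. Dempster's rule of conditioning: for a basic belief assignment $m$ on $2^\Theta$ and $A\in 2^\Theta$, $A\ne\emptyset$, let $m_A$ be the basic belief assignment with $m_A(A)=1$. Then for $B\in 2^\Theta$, $$m(B|A)=\frac{\sum_{X,Y\in 2^\Theta,\ X\cap Y=B} m(X)m_A(Y)}{1-\sum_{X,Y\in 2^\Theta,\ X\cap Y=\emptyset} m(X)m_A(Y)}.$$ *)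

(* Defs.v *)
From mathcomp Require Import all_boot all_order all_algebra.
From mathcomp Require Import reals.

Set Implicit Arguments.
Unset Strict Implicit.
Unset Printing Implicit Defensive.

Import Order.TTheory GRing.Theory Num.Theory.
Local Open Scope ring_scope.

(* Shafer's model: the frame of discernment is 'I_n, the hypothesis theta_i is
   identified with the singleton [set i], and 2^Theta is {set 'I_n}. *)
Definition mass (R : realType) (n : nat) := {ffun {set 'I_n} -> R}.

Definition is_bba (R : realType) (n : nat) (m : mass R n) : Prop :=
  [/\ forall A : {set 'I_n}, 0 <= m A <= 1,
      m set0 = 0
    & \sum_(A : {set 'I_n}) m A = 1].

(* The assignment m_A. Nonnegativity and total mass 1 force every mass other
   than that of A to vanish; it is a basic belief assignment iff A != set0. *)
Definition bba_certain (R : realType) (n : nat) (A : {set 'I_n}) : mass R n :=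
  [ffun X => (X == A)%:R].

Definition conj_mass (R : realType) (n : nat) (m m' : mass R n)
    (B : {set 'I_n}) : R :=
  \sum_(X : {set 'I_n}) \sum_(Y : {set 'I_n} | X :&: Y == B) m X * m' Y.

Definition dempster_den (R : realType) (n : nat) (m m' : mass R n) : R :=
  1 - conj_mass m m' set0.

(* m(B|A), or None when the quotient is undefined (division in R is total, so
   the quotient alone would not record this). The requirement A != set0 needs
   no separate test: if A = set0 and m has total mass 1, every X meets A in
   set0, so the denominator is 0. *)
Definition dempster_cond (R : realType) (n : nat) (m : mass R n)
    (A B : {set 'I_n}) : option R :=
  let mA := bba_certain R A in
  if dempster_den m mA == 0 then None
  else Some (conj_mass m mA B / dempster_den m mA).

(* Main.v *)
Require Import Defs.
From mathcomp Require Import all_boot all_order all_algebra.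
From mathcomp Require Import reals.

Import Order.TTheory GRing.Theory Num.Theory.
Local Open Scope ring_scope.

(** The product mass [m1 X * m2 Y] is concentrated on the single pair [([set i], [set j])], which is
    disjoint because [i != j]. The conflict is therefore the whole mass 1, and the denominator
    vanishes. *)

Theorem mainTheorem5 (R : realType) (n : nat) (hn : (2 <= n)%N)
  (m1 m2 : mass R n) (hm1 : is_bba m1) (hm2 : is_bba m2)
  (i j : 'I_n) (hij : i != j)
  (h1 : m1 [set i] = 1) (h1' : forall A : {set 'I_n}, A != [set i] -> m1 A = 0)
  (h2 : m2 [set j] = 1) (h2' : forall A : {set 'I_n}, A != [set j] -> m2 A = 0) :
  [/\ m2 = bba_certain R [set j],
      1 - \sum_(X : {set 'I_n}) \sum_(Y : {set 'I_n} | X :&: Y == set0)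
            m1 X * m2 Y = 0,
      dempster_den m1 m2 = 0
    & forall B : {set 'I_n}, dempster_cond m1 [set j] B = None].
Proof.
have m2E : m2 = bba_certain R [set j].
  by apply/ffunP => A; rewrite ffunE; case: eqVneq => [-> | /h2'].
have disj : [set i] :&: [set j] == set0 :> {set 'I_n}.
  by rewrite setI_eq0 disjoints1 inE.
have conj1 : conj_mass m1 m2 set0 = 1.
  rewrite /conj_mass (bigD1 [set i]) //= [X in _ + X]big1 ?addr0; last first.
    by move=> X /h1' ->; rewrite big1 // => Y _; rewrite mul0r.
  (* Here [disj] matters: it places [[set j]] in the range of the inner sum, so the term 1 really is
     counted as conflict. *)
  rewrite (bigD1 [set j]) //= h1 h2 mulr1 big1 ?addr0 // => Y /andP[_ /h2' ->].
  by rewrite mulr0.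
have den0 : dempster_den m1 m2 = 0 by rewrite /dempster_den conj1 subrr.
(* The explicit double sum is [den0] up to unfolding; [m2E] carries [den0] over to the test in
   [dempster_cond]. *)
by split=> // B; rewrite /dempster_cond -m2E den0 eqxx.
Qed.
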